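(* Let $A$ be a singular $n\times n$ complex matrix whose Jordan canonical form is $$J=\begin{bmatrix} J_0&0&0\\0&J_1&0\\0&0&J_2\end{bmatrix},$$ where $J_0$, $J_1$, $J_2$ are as described in the context ($J_0$ collects all Jordan blocks for the eigenvalue $0$, and $J_1,J_2$ collect those for the nonzero eigenvalues, split so that $J_2$ corresponds to $-\nu_1,\dots,-\nu_k$). Then the anti-commuting solutions of $JYJ=YJY$ are exactly the matrices $$K=\begin{bmatrix} K_1&0&0\\0&0&0\\0&0&0\end{bmatrix}$$ (partitioned conformably with $J$), where $K_1$ satisfies $J_0K_1=-K_1J_0$ and $K_1(K_1-J_0)J_0=0$; in other words, $K_1$ ranges over all the anti-commuting solutions of $J_0YJ_0=YJ_0Y$.
   Context: For a square complex matrix $M$, an anti-commuting solution of $MYM=YMY$ is a square complex matrix $K$ of the same size as $M$ with $MKM=KMK$ and $MK=-KM$. Setup for $J$: let $d$ be the number of distinct eigenvalues of $A$, one of which is $0$. The nonzero distinct eigenvalues are written as $\mu_1,\dots,\mu_{d-2k-1},\nu_1,-\nu_1,\dots,\nu_k,-\nu_k$ with $0\le k<d/2$, where $-\mu_i$ is not an eigenvalue of $J$ for $i=1,\dots,d-2k-1$. The Jordan blocks of $J$ are ordered so that $J=\mathrm{diag}(J_0,J_1,J_2)$, where $J_0$ is the block diagonal matrix of all Jordan blocks with eigenvalue $0$, $J_1$ is the block diagonal matrix of all Jordan blocks with eigenvalues $\mu_1,\dots,\mu_{d-2k-1},\nu_1,\dots,\nu_k$, and $J_2$ is the block diagonal matrix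 of all Jordan blocks with eigenvalues $-\nu_1,\dots,-\nu_k$. If there are no eigenvalues of one of these kinds, the corresponding block is empty. Jordan blocks are upper triangular, with $1$'s on the superdiagonal. *)

(* Defs.v *)
From mathcomp Require Import all_boot all_order all_algebra.
From mathcomp Require Export reals complex.

Set Implicit Arguments.
Unset Strict Implicit.
Unset Printing Implicit Defensive.

Import GRing.Theory.
Local Open Scope ring_scope.

Definition anticommuting_solution (F : fieldType) (n : nat) (M K : 'M[F]_n) :
    Prop :=
  M *m K *m M = K *m M *m K /\ M *m K = - (K *m M).

Definition jordan_block (F : fieldType) (a : F) (p : nat) : 'M[F]_p :=
  \matrix_(i < p, j < p) (a *+ (i == j) + (i.+1 == j :> nat)%:R).

Definition jordan_mx (F : fieldType) (r : nat) (s : 'I_r -> nat)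
    (l : 'I_r -> F) : 'M[F]_(\sum_(i < r) s i) :=
  \mxdiag_(i < r) jordan_block (l i) (s i).

Definition diag3_mx (F : fieldType) (n0 n1 n2 : nat) (X : 'M[F]_n0)
    (Y : 'M[F]_n1) (Z : 'M[F]_n2) : 'M[F]_(n0 + (n1 + n2)) :=
  block_mx X 0 0 (block_mx Y 0 0 Z).

(* Main.v *)
Require Import Defs.
From mathcomp Require Import all_boot all_order all_algebra.
Import GRing.Theory.
Local Open Scope ring_scope.

(** Anti-commutation moves the two ends of each product together:
    [J K J = - K J^2] and [K J K = - K^2 J], so for an anti-commuting [K] the
    equation [J K J = K J K] is the polynomial condition [K (K - J) J = 0]
    ([anticommuting_solutionP]).

    Write [J = diag(J0, N)], where [N = diag(J1, J2)] collects the nonzero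
    eigenvalues: [J0] is nilpotent ([jordan_mx0_nilp]) and [N] is invertible
    ([jordan_mx_unit]).  The off-diagonal blocks of [K] solve homogeneous
    Sylvester equations [J0 X = - X N] and [N Y = - Y J0]; as [J0] and [N] are
    nilpotent and invertible, these have only the zero solution
    ([sylvester_nilp_unit], [sylvester_unit_nilp]).  The lower right block of
    [K] is an anti-commuting solution [Z] for [N].  Cancelling [N] in
    [Z (Z - N) N = 0] gives [Z N = Z^2], so that [Z] commutes with [Z N]; it
    also anti-commutes with it, hence [2 Z^2 N = 0] and [Z = 0]
    ([anticommuting_solution_unit]).  What remains is the condition on the upper
    left block. *)

Lemma anticommuting_solutionP (F : fieldType) (n : nat) (M K : 'M[F]_n) :
  anticommuting_solution M K <->
  M *m K = - (K *m M) /\ K *m (K - M) *m M = 0.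
Proof.
have key : M *m K = - (K *m M) ->
    K *m (K - M) *m M = M *m K *m M - K *m M *m K.
  move=> anti; rewrite -[K *m M *m K]mulmxA anti mulNmx mulmxN mulmxA opprK.
  by rewrite mulmxBr mulmxBl addrC.
split=> [[sol anti]|[anti eq0]]; split=> //; first by rewrite key // sol subrr.
by apply/eqP; rewrite -subr_eq0 -key // eq0.
Qed.

(** * Sylvester equations and invertible matrices *)

Lemma mulmx_unit_eq0l (F : fieldType) (m n : nat) (X : 'M[F]_(m, n))
    (B : 'M[F]_n) :
  B \in unitmx -> X *m B = 0 -> X = 0.
Proof. by move=> uB XB0; rewrite -[X](mulmxK uB) XB0 mul0mx. Qed.

Lemma mulmx_unit_eq0r (F : fieldType) (m n : nat) (B : 'M[F]_m)
    (X : 'M[F]_(m, n)) :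
  B \in unitmx -> B *m X = 0 -> X = 0.
Proof. by move=> uB BX0; rewrite -[X](mulKmx uB) BX0 mulmx0. Qed.

(** From [A^(e+1) X = 0] follows [A^e X B = - A^e A X = 0], and cancelling [B]
    lowers the exponent until [X = 0]. *)
Lemma sylvester_nilp_unit (F : fieldType) (m n e : nat) (A : 'M[F]_m)
    (B : 'M[F]_n) (X : 'M[F]_(m, n)) :
  A ^+ e = 0 -> B \in unitmx -> A *m X = - (X *m B) -> X = 0.
Proof.
move=> Ae0 uB AX.
have: A ^+ e *m X = 0 by rewrite Ae0 mul0mx.
elim: e {Ae0} => [|e IHe]; first by rewrite expr0 mul1mx.
rewrite exprSr -[_ * A]/(_ *m A) -mulmxA AX mulmxN mulmxA => /eqP.
by rewrite oppr_eq0 => /eqP/(mulmx_unit_eq0l _ _ _ _ _ uB).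
Qed.

Lemma sylvester_unit_nilp (F : fieldType) (m n e : nat) (A : 'M[F]_m)
    (B : 'M[F]_n) (Y : 'M[F]_(n, m)) :
  A ^+ e = 0 -> B \in unitmx -> B *m Y = - (Y *m A) -> Y = 0.
Proof.
move=> Ae0 uB BY.
have YA : Y *m A = - (B *m Y) by rewrite BY opprK.
have: Y *m A ^+ e = 0 by rewrite Ae0 mulmx0.
elim: e {Ae0} => [|e IHe]; first by rewrite expr0 mulmx1.
rewrite exprS -[A * _]/(A *m _) mulmxA YA mulNmx -mulmxA => /eqP.
by rewrite oppr_eq0 => /eqP/(mulmx_unit_eq0r _ _ _ _ _ uB).
Qed.

(** Cancelling the invertible [N] gives [Z N = Z^2], which commutes with [Z],
    whereas anti-commutation turns [Z N Z] into [- Z^2 N]; hence [2 Z^2 N = 0],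
    so [Z^2 = 0], so [Z N = 0]. *)
Lemma anticommuting_solution_unit (F : fieldType) (n : nat) (N Z : 'M[F]_n) :
  2%:R != 0 :> F -> N \in unitmx -> anticommuting_solution N Z -> Z = 0.
Proof.
move=> F2 uN /anticommuting_solutionP [anti].
move/(mulmx_unit_eq0l _ _ _ _ _ uN)/eqP.
rewrite mulmxBr subr_eq0 => /eqP sqZ.
have ZZN : Z *m Z *m N = - (Z *m Z *m N).
  rewrite -[LHS]mulmxA -sqZ [LHS]mulmxA [in LHS]sqZ.
  by rewrite -[LHS]mulmxA anti mulmxN mulmxA.
have ZZN0 : Z *m Z *m N = 0.
  apply/eqP; move/eqP: ZZN; rewrite -addr_eq0 -mulr2n -scaler_nat scaler_eq0.
  by rewrite (negbTE F2).
apply: (mulmx_unit_eq0l _ _ _ _ _ uN).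
by rewrite -sqZ (mulmx_unit_eq0l _ _ _ _ _ uN ZZN0).
Qed.

(** * Jordan matrices *)

Lemma jordan_block_unit (F : fieldType) (a : F) (p : nat) :
  a != 0 -> jordan_block a p \in unitmx.
Proof.
move=> a0; rewrite unitmxE -det_tr det_trig; last first.
  apply/is_trig_mxP => i j lt_ij; rewrite !mxE.
  by rewrite -val_eqE /= (gtn_eqF lt_ij) (gtn_eqF (leqW lt_ij)) addr0.
rewrite unitfE; apply/prodf_neq0 => i _.
by rewrite !mxE eqxx gtn_eqF // addr0.
Qed.

Lemma jordan_mx_unit (F : fieldType) (r : nat) (s : 'I_r -> nat)
    (l : 'I_r -> F) :
  (forall i, l i != 0) -> jordan_mx s l \in unitmx.
Proof.
move=> l0; rewrite -row_free_unit /row_free rank_mxdiag; apply/eqP.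
by apply: eq_bigr => i _; apply: mxrank_unit; apply: jordan_block_unit.
Qed.

Lemma jordan_block0_exp (F : fieldType) (p e : nat) (i j : 'I_p) :
  (jordan_block (0 : F) p ^+ e) i j = ((i + e)%N == j)%:R.
Proof.
elim: e i j => [|e IHe] i j; first by rewrite expr0 mxE addn0.
rewrite exprSr -[_ * _]/(_ *m _) mxE.
under eq_bigr => k _ do rewrite IHe mxE mul0rn add0r.
have [lt_p|ge_p] := ltnP (i + e)%N p.
  rewrite (bigD1 (Ordinal lt_p)) //= eqxx mul1r addnS big1 ?addr0 // => k.
  by rewrite -val_eqE /= eq_sym => /negbTE ->; rewrite mul0r.
(* The [e]-shift of [i] already leaves the block. *)
rewrite big1 => [|k _]; last by rewrite gtn_eqF ?mul0r // (leq_trans _ ge_p).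
by rewrite gtn_eqF // addnS ltnS (leq_trans (ltnW _) ge_p).
Qed.

Lemma mulmx_mxdiag (F : fieldType) (r : nat) (s : 'I_r -> nat)
    (B C : forall i, 'M[F]_(s i)) :
  \mxdiag_i B i *m \mxdiag_i C i = \mxdiag_i (B i *m C i).
Proof.
rewrite {2}/mxdiag mul_mxdiag_mxblock /mxdiag; apply/eq_mxblock => i j.
by case: eqVneq => [<-|_]; rewrite ?mulmx0 // !conform_mx_id.
Qed.

Lemma exp_mxdiag (F : fieldType) (r : nat) (s : 'I_r -> nat)
    (B : forall i, 'M[F]_(s i)) (e : nat) :
  (\mxdiag_i B i) ^+ e = \mxdiag_i (B i ^+ e).
Proof.
elim: e => [|e IHe]; first by rewrite expr0 mxdiagZ.
rewrite exprS IHe -[_ * _]/(_ *m _) mulmx_mxdiag.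
by apply: eq_mxdiag => i; rewrite exprS.
Qed.

(** The total size bounds the size of every block, so it is an exponent that
    kills all the blocks at once. *)
Lemma jordan_mx0_nilp (F : fieldType) (r : nat) (s : 'I_r -> nat) :
  jordan_mx s (fun _ => 0 : F) ^+ (\sum_(i < r) s i) = 0.
Proof.
rewrite exp_mxdiag -[RHS]mxdiag0; apply: eq_mxdiag => i.
apply/matrixP => a b; rewrite jordan_block0_exp mxE gtn_eqF //.
rewrite (leq_trans (ltn_ord b)) // (leq_trans _ (leq_addl _ _)) //.
by rewrite (bigD1 i) //= leq_addr.
Qed.

(** * Direct sums of a nilpotent and an invertible matrix *)

Lemma anticommuting_solution_block (F : fieldType) (m n : nat) (A : 'M[F]_m)
    (N : 'M[F]_n) (K1 : 'M[F]_m) (Z : 'M[F]_n) :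
  anticommuting_solution (block_mx A 0 0 N) (block_mx K1 0 0 Z) <->
  anticommuting_solution A K1 /\ anticommuting_solution N Z.
Proof.
rewrite /anticommuting_solution !mulmx_block !(mul0mx, mulmx0, addr0, add0r).
rewrite opp_block_mx !oppr0.
split=> [[/eq_block_mx[? _ _ ?] /eq_block_mx[? _ _ ?]] //|].
by case=> [[eqA antiA] [eqN antiN]]; split; congr block_mx.
Qed.

(** As in the Fitting decomposition, the nilpotent and the invertible part have
    no eigenvalue in common, even up to sign, so a matrix that anti-commutes
    with [diag(A, N)] preserves both. *)
Lemma anticommuting_block_diag (F : fieldType) (m n e : nat) (A : 'M[F]_m)
    (N : 'M[F]_n) (K : 'M[F]_(m + n)) :
  A ^+ e = 0 -> N \in unitmx ->
  block_mx A 0 0 N *m K = - (K *m block_mx A 0 0 N) ->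
  K = block_mx (ulsubmx K) 0 0 (drsubmx K).
Proof.
move=> Ae0 uN; rewrite -{1 2 3}[K]submxK !mulmx_block opp_block_mx.
rewrite !(mul0mx, mulmx0, addr0, add0r) => /eq_block_mx[_ X Y _].
by rewrite (sylvester_nilp_unit _ _ _ _ _ _ _ Ae0 uN X)
  (sylvester_unit_nilp _ _ _ _ _ _ _ Ae0 uN Y).
Qed.

Lemma anticommuting_solution_nilp_unit (F : fieldType) (m n e : nat)
    (A : 'M[F]_m) (N : 'M[F]_n) (K : 'M[F]_(m + n)) :
  2%:R != 0 :> F -> A ^+ e = 0 -> N \in unitmx ->
  anticommuting_solution (block_mx A 0 0 N) K <->
  exists K1, K = block_mx K1 0 0 0 /\ anticommuting_solution A K1.
Proof.
move=> F2 Ae0 uN; split=> [solK|[K1 [-> solK1]]]; last first.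
  apply/anticommuting_solution_block; split=> //.
  by split; rewrite !(mulmx0, mul0mx) ?oppr0.
have defK := anticommuting_block_diag _ _ _ _ _ _ _ Ae0 uN solK.2.
exists (ulsubmx K); move: solK; rewrite {1}defK.
move/anticommuting_solution_block => [sol1 /anticommuting_solution_unit Z0].
by rewrite {1}defK Z0.
Qed.

Theorem theorem3p9 (R : realType) (n : nat) (A : 'M[R[i]]_n)
    (d k : nat) (mu : (d - k.*2 - 1)%N.-tuple R[i]) (nu : k.-tuple R[i])
    (r0 r1 r2 : nat)
    (s0 : 'I_r0 -> nat) (s1 : 'I_r1 -> nat) (s2 : 'I_r2 -> nat)
    (l1 : 'I_r1 -> R[i]) (l2 : 'I_r2 -> R[i])
    (size_eq : (\sum_(i < r0) s0 i +
                 (\sum_(i < r1) s1 i + \sum_(i < r2) s2 i))%N = n) :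
  let nuN := [seq - x | x <- nu] in
  let J0 := jordan_mx s0 (fun _ => 0) in
  let J1 := jordan_mx s1 l1 in
  let J2 := jordan_mx s2 l2 in
  let J := diag3_mx J0 J1 J2 in
  A \notin unitmx ->
  (k.*2 < d)%N ->
  uniq (0 :: mu ++ nu ++ nuN) ->
  (forall a : R[i], eigenvalue A a = (a \in 0 :: mu ++ nu ++ nuN)) ->
  (forall a : R[i], a \in mu -> ~~ eigenvalue J (- a)) ->
  (forall i, 0 < s0 i)%N -> (forall i, 0 < s1 i)%N -> (forall i, 0 < s2 i)%N ->
  (forall i, l1 i \in mu ++ nu) ->
  (forall i, l2 i \in nuN) ->
  similar_in unitmx A (castmx (size_eq, size_eq) J) ->
  (forall K : 'M[R[i]]_(\sum_(i < r0) s0 i +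
                         (\sum_(i < r1) s1 i + \sum_(i < r2) s2 i)),
     anticommuting_solution J K <->
     exists K1 : 'M[R[i]]_(\sum_(i < r0) s0 i),
       K = diag3_mx K1 0 0 /\
       (J0 *m K1 = - (K1 *m J0) /\ K1 *m (K1 - J0) *m J0 = 0)) /\
  (forall K1 : 'M[R[i]]_(\sum_(i < r0) s0 i),
     (J0 *m K1 = - (K1 *m J0) /\ K1 *m (K1 - J0) *m J0 = 0) <->
     anticommuting_solution J0 K1).
Proof.
move=> nuN J0 J1 J2 J _ _ uniq_ev _ _ _ _ _ l1P l2P _.
have [ev1 ev2] : 0 \notin mu ++ nu /\ 0 \notin nuN.
  by move: uniq_ev; rewrite cons_uniq catA mem_cat negb_or => /andP[/andP[]].
have uN : block_mx J1 0 0 J2 \in unitmx.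
  rewrite block_diag_mx_unit; apply/andP; split; apply: jordan_mx_unit => i.
    by apply: contraNneq ev1 => <-.
  by apply: contraNneq ev2 => <-.
have C2 : 2%:R != 0 :> R[i] by rewrite Num.Theory.pnatr_eq0.
have diag00 K1 : diag3_mx K1 0 0 = block_mx K1 0 0 0 :> 'M_(_ + (_ + _)).
  by rewrite /diag3_mx block_mx0.
split=> [K|K1]; last by split=> /anticommuting_solutionP.
have [sol1 sol2] := anticommuting_solution_nilp_unit _ _ _ _ _ _ K C2
  (jordan_mx0_nilp _ _ s0) uN.
split=> [/sol1 [K1 [defK solK1]]|[K1 [defK condK1]]].
  by exists K1; rewrite diag00; split=> //; apply/anticommuting_solutionP.
apply: sol2; exists K1; rewrite -diag00; split=> //.
exact/anticommuting_solutionP.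
Qed.
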